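(* Let $H$ be a real Hilbert space, let $K_1,\ldots,K_n$ be closed convex cones in $H$ such that $K_1\cap\cdots\cap K_n=\{0\}$, and let $\zeta$ be a norm on $\mathbb{R}^n$ that is coordinatewise monotone on $\mathbb{R}_+^n$. Suppose in addition that there is a permutation $\pi$ of $\{1,\ldots,n\}$ such that $-K_i=K_{\pi(i)}$ for $i=1,\ldots,n$, and that $\zeta$ is invariant under the corresponding permutation of coordinates, i.e. $\zeta(a_{\pi(1)},\ldots,a_{\pi(n)})=\zeta(a_1,\ldots,a_n)$ for all $(a_1,\ldots,a_n)\in\mathbb{R}^n$. Then the function $\eta:H\to\mathbb{R}$ defined by \[ \eta(x)=\zeta\bigl(d(x,K_1),\ldots,d(x,K_n)\bigr) \] is a norm on $H$.
   Context: $H$ is a real Hilbert space with norm $\lVert\cdot\rVert$. A closed convex cone is a nonempty closed set $K\subseteq H$ such that $\lambda x+\mu y\in K$ for all $x,y\in K$ and all real $\lambda,\mu\ge 0$. $d(x,K)=\min_{y\in K}\lVert x-y\rVert$ is the distance from $x$ to $K$. $\mathbb{R}_+=\{t\in\mathbb{R}:t\ge 0\}$. A norm $\zeta$ on $\mathbb{R}^n$ is coordinatewise monotone on $\mathbb{R}_+^n$ if $0\le a_i\le b_i$ for $i=1,\ldots,n$ implies $\zeta(a_1,\ldots,a_n)\le\zeta(b_1,\ldots,b_n)$. *)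

(* Defs.v *)
From HB Require Import structures.
From mathcomp Require Export all_boot all_order all_fingroup all_algebra.
From mathcomp Require Export all_classical all_reals all_analysis.
Export numFieldNormedType.Exports.

Set Implicit Arguments.
Unset Strict Implicit.
Unset Printing Implicit Defensive.

Import Order.TTheory GRing.Theory Num.Theory.

Local Open Scope classical_set_scope.
Local Open Scope ring_scope.

Definition is_norm (R : realType) (V : lmodType R) (N : V -> R) : Prop :=
  [/\ forall x, 0 <= N x,
      forall x, N x = 0 -> x = 0,
      forall (a : R) x, N (a *: x) = `|a| * N x &
      forall x y, N (x + y) <= N x + N y].

Definition monotone_on_orthant (R : realType) (n : nat)
    (N : 'rV[R]_n -> R) : Prop :=
  forall a b : 'rV[R]_n,
    (forall i, 0 <= a ord0 i <= b ord0 i) -> N a <= N b.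

Definition closed_convex_cone (R : realType) (H : normedModType R)
    (K : set H) : Prop :=
  [/\ K !=set0,
      closed K &
      forall (x y : H) (l m : R), K x -> K y -> 0 <= l -> 0 <= m ->
        K (l *: x + m *: y)].

(* [A `&` lbound A] has at most one element, the minimum of [A]; the default
   value 0 is only taken when [A] has no minimum. *)
Definition set_min (R : realType) (A : set R) : R := xget 0 (A `&` lbound A).

Lemma set_minE (R : realType) (A : set R) (r : R) :
  A r -> lbound A r -> set_min A = r.
Proof.
move=> Ar lr; apply: xget_unique => // s [As ls].
by apply/le_anti; rewrite ls// lr.
Qed.

(* For a closed convex [K] in a Hilbert space the minimum is attained, by the
   projection theorem. *)
Definition dist_to (R : realType) (H : normedModType R)
    (x : H) (K : set H) : R :=
  set_min [set `|x - y| | y in K].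

(* Main.v *)
Require Import Defs.
From mathcomp Require Import lra.

(** Write [d i x] for the distance from [x] to [K i].  The distance to a
    convex cone is a sublinear functional: a sum of points of [K i] is again
    in [K i], which gives [d i (x + y) <= d i x + d i y], and rescaling [K i]
    by a positive factor does not change it, which gives
    [d i (a *: x) = a * d i x] for [0 <= a] ([dist_toD], [dist_toZ]).
    Monotonicity of [zeta] on the orthant turns the coordinatewise
    subadditivity into the triangle inequality for [eta].

    What a cone does not give is symmetry: [d i (- x)] is the distance from
    [x] to [- K i = K (pi i)] ([dist_toN]).  So replacing [x] by [- x] permutes
    the coordinates of the vector of distances by [pi], and [zeta] does not see
    this permutation.  Definiteness holds because [d i x = 0] forces
    [x \in K i], and the cones meet only at [0].

    All of this needs the minimum in the definition of the distance to be
    attained, and this is where the Hilbert space structure enters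
    ([nearest_point_exists]): by the parallelogram law, points of a convex set
    that almost realise the infimum of the distances to [x] are close to one
    another, so they form a Cauchy filter, whose limit is a nearest point. *)

Import Order.TTheory GRing.Theory Num.Theory.

Local Open Scope classical_set_scope.
Local Open Scope ring_scope.

(** * Nearest points in closed convex sets *)

Lemma parallelogram (R : realType) (H : normedModType R)
    (dot : {dot H for idfun})
    (norm_dot : forall x : H, `|x| = Num.sqrt (dot x x)) (x y : H) :
  `|x + y| ^+ 2 + `|x - y| ^+ 2 = 2 * (`|x| ^+ 2 + `|y| ^+ 2).
Proof.
have dot_ge0 z : 0 <= dot z z.
  by have [->|z0] := eqVneq z 0; [rewrite linear0l | exact/ltW/neq0_dnorm_gt0].
rewrite !norm_dot !sqr_sqrtr//.
have -> : dot (x + y) (x + y) = dot x x + dot x y + (dot y x + dot y y).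
  by rewrite linearDl !linearDr.
have -> : dot (x - y) (x - y) = dot x x - dot x y - (dot y x - dot y y).
  by rewrite linearBl !linearBr.
lra.
Qed.

(** Let [D] be the infimum of the distances from [x] to [K].  If [y] and [z] in
    [K] are within [D + e] of [x], their midpoint lies in [K], hence at
    distance at least [D] from [x], and the parallelogram law for [x - y] and
    [x - z] bounds [`|y - z| ^+ 2] by [4 * (D + e) ^+ 2 - 4 * D ^+ 2], which
    tends to [0] with [e]. *)
Lemma nearest_point_exists (R : realType) (H : completeNormedModType R)
    (plaw : forall x y : H,
      `|x + y| ^+ 2 + `|x - y| ^+ 2 = 2 * (`|x| ^+ 2 + `|y| ^+ 2))
    (K : set H) (x : H) :
  K !=set0 -> closed K ->
  (forall y z, K y -> K z -> K (2^-1 *: (y + z))) ->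
  exists2 p, K p & forall y, K y -> `|x - p| <= `|x - y|.
Proof.
move=> [y0 Ky0] clK midK.
pose A := [set `|x - y| | y in K]; pose D := inf A.
have A0 : A !=set0 by exists `|x - y0|, y0.
have lbA : has_lbound A by exists 0 => _ [y _ <-].
have D_le y : K y -> D <= `|x - y| by move=> Ky; apply: ge_inf => //; exists y.
have D_ge0 : 0 <= D by apply: lb_le_inf => // _ [y _ <-].
pose B e := [set y | K y /\ `|x - y| < D + e].
have B0 e : 0 < e -> B e !=set0.
  move=> e0; have [_ [y Ky <-] ye] := inf_adherent e0 (conj A0 lbA).
  by exists y.
pose F := filter_from [set e : R | 0 < e] B.
have FF : ProperFilter F.
  apply: filter_from_proper => //; apply: filter_from_filter.
    by exists 1 => /=.
  move=> i j /= i0 j0; exists (Num.min i j); first by rewrite /= lt_min i0.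
  move=> y [Ky]; rewrite /= -ltrBlDl lt_min !ltrBlDl => /andP[yi yj].
  by split.
have close e y z : 0 < e -> B e y -> B e z ->
    `|y - z| ^+ 2 <= 8 * D * e + 4 * e ^+ 2.
  move=> e0 [Ky ye] [Kz ze].
  have := plaw (x - y) (x - z).
  have -> : x - y - (x - z) = - (y - z).
    by rewrite !opprB addrC subrKA.
  have -> : x - y + (x - z) = 2%:R *: (x - 2^-1 *: (y + z)).
    by rewrite scalerBr scalerA divff// scale1r scaler_nat mulr2n opprD addrACA.
  rewrite normrN normrZ normr_nat.
  have := D_le _ (midK _ _ Ky Kz).
  set m := `|x - 2^-1 *: _|; move=> Dm.
  have m0 : 0 <= m by exact: normr_ge0.
  have mD : D ^+ 2 <= m ^+ 2 by rewrite ler_sqr ?nnegrE.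
  have y2 : `|x - y| ^+ 2 <= (D + e) ^+ 2.
    by rewrite ler_sqr ?nnegrE// ?addr_ge0// ltW.
  have z2 : `|x - z| ^+ 2 <= (D + e) ^+ 2.
    by rewrite ler_sqr ?nnegrE// ?addr_ge0// ltW.
  nra.
have cF : cauchy F.
  apply: cauchy_exP => e e0.
  (* This choice gives [8 * D * d + 4 * d ^+ 2 < e ^+ 2]. *)
  pose d := Num.min (e / 4) (e ^+ 2 / (16 * (D + 1))).
  have D1 : 0 < 16 * (D + 1) by lra.
  have d0 : 0 < d by rewrite lt_min !divr_gt0// exprn_gt0.
  have [p Bp] := B0 _ d0; exists p, d => //= y By.
  rewrite -ball_normE /=.
  have := close _ _ _ d0 Bp By.
  have d1 : d <= e / 4 by rewrite ge_min lexx.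
  have d2 : d * (16 * (D + 1)) <= e ^+ 2.
    by rewrite -ler_pdivlMr// ge_min lexx orbT.
  move=> h; rewrite -ltr_sqr ?nnegrE// ?ltW//.
  nra.
have Fp := @cauchy_cvg _ F FF cF; set p := lim F in Fp.
have closedFp C : closed C -> F C -> C p.
  by move=> clC FC; exact: (@closed_cvg _ _ F FF idfun C clC FC p Fp).
exists p => [|y Ky]; first by apply: closedFp => //; exists 1 => //= z [].
apply: le_trans (D_le _ Ky); apply/ler_addgt0Pr => e e0.
apply: (closedFp (closed_ball_ Num.norm x (D + e))).
  exact: closed_closed_ball_.
by exists e => //= z [_ /ltW].
Qed.

(** * Distance to a closed convex cone *)

Section distance_to_cone.
Variables (R : realType) (H : completeNormedModType R).
Hypothesis plaw : forall x y : H,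
  `|x + y| ^+ 2 + `|x - y| ^+ 2 = 2 * (`|x| ^+ 2 + `|y| ^+ 2).
Implicit Types (K : set H) (x y : H).

Lemma dist_to_nearest K x p :
  K p -> (forall y, K y -> `|x - p| <= `|x - y|) -> dist_to x K = `|x - p|.
Proof.
move=> Kp pmin; apply: set_minE; first by exists p.
by move=> _ [y Ky <-]; exact: pmin.
Qed.

Lemma cone_nearest_point {K} x : closed_convex_cone K ->
  exists p, [/\ K p, dist_to x K = `|x - p| &
                forall y, K y -> `|x - p| <= `|x - y|].
Proof.
move=> [K0 clK coneK].
have [|p Kp pmin] := @nearest_point_exists _ _ plaw K x K0 clK.
  by move=> y z Ky Kz; rewrite scalerDr; apply: coneK; rewrite ?invr_ge0.
by exists p; split=> //; exact: dist_to_nearest.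
Qed.

Lemma dist_to_ge0 K x : closed_convex_cone K -> 0 <= dist_to x K.
Proof. by move=> /cone_nearest_point -/(_ x)[p [_ -> _]]. Qed.

Lemma dist_to_eq0 K x : closed_convex_cone K -> dist_to x K = 0 -> K x.
Proof.
move=> /cone_nearest_point -/(_ x)[p [Kp -> _]] /normr0_eq0/subr0_eq.
by move->.
Qed.

Lemma dist_toD K x y : closed_convex_cone K ->
  dist_to (x + y) K <= dist_to x K + dist_to y K.
Proof.
move=> coneK.
have [p [Kp -> _]] := cone_nearest_point x coneK.
have [q [Kq -> _]] := cone_nearest_point y coneK.
have [r [_ -> rmin]] := cone_nearest_point (x + y) coneK.
have Kpq : K (p + q).
  by rewrite -(scale1r p) -(scale1r q); case: coneK => _ _; apply.
apply: le_trans (rmin _ Kpq) _.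
by rewrite opprD addrACA ler_normD.
Qed.

(** Rescaling by a positive factor permutes the points of the cone, so it
    carries a nearest point to a nearest point. *)
Lemma dist_toZ K (a : R) x : closed_convex_cone K -> 0 <= a ->
  dist_to (a *: x) K = a * dist_to x K.
Proof.
move=> coneK a0.
have KZ b z : 0 <= b -> K z -> K (b *: z).
  move=> b0 Kz; rewrite -[_ *: _]addr0 -(scale0r z).
  by case: coneK => _ _; apply.
have [p [Kp -> pmin]] := cone_nearest_point x coneK.
have normZB z : `|a *: x - a *: z| = a * `|x - z|.
  by rewrite -scalerBr normrZ ger0_norm.
rewrite -normZB; apply: dist_to_nearest => [|y Ky]; first exact: KZ.
rewrite normZB; have [->|a_neq0] := eqVneq a 0; first by rewrite mul0r.
have -> : y = a *: (a^-1 *: y) by rewrite scalerA divff// scale1r.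
by rewrite normZB ler_wpM2l//; apply/pmin/KZ; rewrite ?invr_ge0.
Qed.

End distance_to_cone.

Lemma dist_toN (R : realType) (H : normedModType R) (K : set H) (x : H) :
  dist_to (- x) K = dist_to x [set - y | y in K].
Proof.
congr set_min; apply/seteqP; split=> [_ [y Ky <-]|_ [_ [y Ky <-] <-]].
  by exists (- y); [exists y | rewrite -opprD normrN opprK].
by exists y => //; rewrite -opprD normrN opprK.
Qed.

(** * The norm *)

Theorem corollary6p4 (R : realType) (H : completeNormedModType R)
    (dot : {dot H for idfun})
    (norm_dot : forall x : H, `|x| = Num.sqrt (dot x x))
    (n : nat) (K : 'I_n -> set H)
    (K_cone : forall i, closed_convex_cone (K i))
    (K_cap : \bigcap_(i in [set: 'I_n]) K i = [set 0])
    (zeta : 'rV[R]_n -> R)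
    (zeta_norm : is_norm zeta)
    (zeta_mono : monotone_on_orthant zeta)
    (pi : {perm 'I_n})
    (K_pi : forall i, [set - x | x in K i] = K (pi i))
    (zeta_pi : forall a : 'rV[R]_n,
      zeta (\row_(i < n) a ord0 (pi i)) = zeta a) :
  is_norm (fun x : H => zeta (\row_(i < n) dist_to x (K i))).
Proof.
have plaw := parallelogram _ _ _ norm_dot.
have [zeta_ge0 zeta_eq0 zetaZ zetaD] := zeta_norm.
have etaN x : zeta (\row_i dist_to (- x) (K i)) = zeta (\row_i dist_to x (K i)).
  rewrite -[RHS]zeta_pi; congr zeta.
  by apply/rowP => i; rewrite !mxE dist_toN K_pi.
have etaZ (a : R) x : 0 <= a ->
    zeta (\row_i dist_to (a *: x) (K i)) = a * zeta (\row_i dist_to x (K i)).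
  move=> a0; rewrite -{2}(ger0_norm a0) -zetaZ; congr zeta.
  by apply/rowP => i; rewrite !mxE dist_toZ.
split=> [x|x /zeta_eq0/rowP dist0|a x|x y].
- exact: zeta_ge0.
- have : (\bigcap_(i in [set: 'I_n]) K i) x.
    move=> i _; apply: (dist_to_eq0 _ _ plaw _ _ (K_cone i)).
    by have := dist0 i; rewrite !mxE.
  by rewrite K_cap.
- have [a0|/ltW a0] := leP 0 a; first by rewrite etaZ// ger0_norm.
  by rewrite -etaN -scaleNr etaZ ?oppr_ge0// ler0_norm.
- apply: le_trans (zetaD _ _); apply: zeta_mono => i; rewrite !mxE.
  by rewrite dist_to_ge0//= dist_toD.
Qed.
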